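(* Let $(D,\mathfrak{m})$ be a pseudo-valuation domain which is not a valuation domain. Then $D$ is a $\star$-domain if and only if $D$ is $2$-root closed and $\mathfrak{m}=\mathfrak{m}^2$.
   Context: A quasi-local domain $(D,\mathfrak{m})$ (a domain with unique maximal ideal $\mathfrak m$, not necessarily Noetherian) with quotient field $K$ is called a pseudo-valuation domain if for all $x,y\in K$, $xy\in\mathfrak{m}$ implies $x\in\mathfrak{m}$ or $y\in\mathfrak{m}$. A domain $D$ is called a $\star$-domain if $a^2D\cap b^2D=(aD\cap bD)^2$ for every $a,b\in D$. A domain $D$ with quotient field $K$ is $2$-root closed if every $x\in K$ with $x^2\in D$ belongs to $D$. *)

(* Defs.v *)
From mathcomp Require Import all_boot all_order all_algebra.
From mathcomp Require Import ring_quotient fraction.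
From mathcomp Require Import boolp classical_sets.

Set Implicit Arguments.
Unset Strict Implicit.
Unset Printing Implicit Defensive.

Import GRing.Theory.

Local Open Scope classical_set_scope.
Local Open Scope ring_scope.

(* [idealr_closed] includes properness ([1 \notin I]).  Ideals are arbitrary
   classical subsets of [D]. *)
Definition maximal_ideal (D : idomainType) (I : set D) : Prop :=
  idealr_closed [in I] /\
  forall J : set D, idealr_closed [in J] -> I `<=` J -> J = I.

Definition quasi_local (D : idomainType) (m : set D) : Prop :=
  maximal_ideal m /\ forall n : set D, maximal_ideal n -> n = m.

Definition principal_ideal (D : idomainType) (a : D) : set D :=
  range (fun d : D => a * d).

Definition ideal_mul (D : idomainType) (I J : set D) : set D :=
  [set x | exists (n : nat) (u v : 'I_n -> D),
     (forall i, I (u i)) /\ (forall i, J (v i)) /\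
     x = \sum_(i < n) u i * v i].

Definition ideal_sqr (D : idomainType) (I : set D) : set D := ideal_mul I I.

Definition in_frac (D : idomainType) (S : set D) : set {fraction D} :=
  @tofrac D @` S.

Definition pseudo_valuation_domain (D : idomainType) (m : set D) : Prop :=
  quasi_local m /\
  forall x y : {fraction D}, in_frac m (x * y) -> in_frac m x \/ in_frac m y.

Definition valuation_domain (D : idomainType) : Prop :=
  forall x : {fraction D}, x != 0 ->
    in_frac [set: D] x \/ in_frac [set: D] x^-1.

Definition star_domain (D : idomainType) : Prop :=
  forall a b : D,
    principal_ideal (a ^+ 2) `&` principal_ideal (b ^+ 2) =
    ideal_sqr (principal_ideal a `&` principal_ideal b).

Definition two_root_closed (D : idomainType) : Prop :=
  forall x : {fraction D}, in_frac [set: D] (x ^+ 2) -> in_frac [set: D] x.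

(* Main.v *)
Require Import Defs.
From mathcomp Require Import all_boot all_order all_algebra.
From mathcomp Require Import ring_quotient fraction.
From mathcomp Require Import boolp classical_sets.

(**
  If [x = b / a] is such that neither [x] nor [x^-1] lies in [D], then
  [x m <= m] and [x^-1 m <= m], whence [D `&` x D = m] and
  [a D `&` b D = a m].  On such pairs the star identity therefore compares
  [a^2 D `&` b^2 D = a^2 (D `&` x^2 D)] with [a^2 m^2], and on pairs where one
  element divides the other it is trivial.  Such an [x] exists because [D] is
  not a valuation domain.  If [D] is 2-root closed, then [D] contains neither
  [x^2] nor [x^-2], so that [D `&` x^2 D = m] and the identity reads [m = m^2].
  Conversely, the identity with [x^2] in [D] and [x] outside [D] would give
  [x^2 D = m^2], hence [x^2] in [m] and [x] in [m].
*)

Set Implicit Arguments.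
Unset Strict Implicit.
Unset Printing Implicit Defensive.

Import GRing.Theory.

Local Open Scope classical_set_scope.
Local Open Scope ring_scope.

Lemma fraction_div (D : idomainType) (x : {fraction D}) :
  exists a b : D, b != 0 /\ x = tofrac a / tofrac b.
Proof.
elim/quotW: x => r; exists (frac r).1, (frac r).2.
have d0 := denom_ratioP r; split=> //.
apply: (canRL (mulfK _)); first by rewrite tofrac_eq0.
unlock FracField.tofrac; rewrite -[LHS]FracField.pi_mul.
apply/eqmodP; rewrite /= FracField.equivfE /FracField.mulf.
by rewrite !numden_Ratio ?mulf_neq0 ?oner_neq0 // !mulr1 mulrC.
Qed.

(** Carries membership of fractions back to divisibility in [D]: for [S] the whole ring, the right
    side is [principal_ideal b a] by conversion. *)
Lemma in_frac_div (D : idomainType) (S : set D) (a b : D) : b != 0 ->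
  in_frac S (tofrac a / tofrac b) <-> [set b * s | s in S] a.
Proof.
move=> b0; have b0' : tofrac b != 0 :> {fraction D} by rewrite tofrac_eq0.
split=> -[s Ss].
  move=> /(canLR (mulfVK b0')) /eqP; rewrite -tofracM tofrac_eq => /eqP <-.
  by exists s; rewrite // mulrC.
by move=> <-; exists s; rewrite // tofracM mulrC mulKf.
Qed.

Lemma not_valuation_domain (D : idomainType) : ~ valuation_domain D ->
  exists a b : D, ~ principal_ideal a b /\ ~ principal_ideal b a.
Proof.
move=> nv; apply: contrapT => nex; apply: nv => x.
have [a [b [b0 ->]]] := fraction_div x.
rewrite mulf_eq0 tofrac_eq0 negb_or => /andP[a0 _]; rewrite invf_div.
apply: contrapT => /not_orP[nx nxV]; apply: nex; exists a, b.
by split=> h; [apply: nxV | apply: nx]; apply/in_frac_div.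
Qed.

Lemma two_root_closedP (D : idomainType) : two_root_closed D <->
  forall a b : D,
    principal_ideal (a ^+ 2) (b ^+ 2) -> principal_ideal a b.
Proof.
split=> [rc a b ab | rc x].
  (* The fraction [b / a] requires [a != 0]; for [a = 0] the assumption forces [b = 0]. *)
  have [a0|a0] := eqVneq a 0.
    exists 0 => //; case: ab => d _ /esym/eqP.
    by rewrite a0 expr0n mul0r sqrf_eq0 => /eqP ->; rewrite mul0r.
  apply/in_frac_div => //; apply: rc.
  rewrite expr_div_n -!tofracXn; apply/in_frac_div => //.
  by rewrite sqrf_eq0.
have [a [b [b0 ->]]] := fraction_div x.
rewrite expr_div_n -!tofracXn => /in_frac_div h.
by apply/in_frac_div => //; apply: rc; apply: h; rewrite sqrf_eq0.
Qed.

Lemma ideal_sqr_mull (D : idomainType) (c : D) (I : set D) :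
  ideal_sqr [set c * x | x in I] = [set c ^+ 2 * x | x in ideal_sqr I].
Proof.
apply/seteqP; split=> y.
  move=> [n [u [v [Iu [Iv ->]]]]].
  (* Choice selects, for each index, a cofactor in [I] of each factor, so that [c ^+ 2] comes out of
     every product. *)
  have [u' u'P] := choice (fun i => let: ex_intro2 x Ix e := Iu i in
    ex_intro (fun x => I x /\ c * x = u i) x (conj Ix e)).
  have [v' v'P] := choice (fun i => let: ex_intro2 x Ix e := Iv i in
    ex_intro (fun x => I x /\ c * x = v i) x (conj Ix e)).
  exists (\sum_(i < n) u' i * v' i).
    exists n, u', v'; split; [|split] => // i; [exact: (u'P i).1|].
    exact: (v'P i).1.
  rewrite mulr_sumr; apply: eq_bigr => i _.
  by rewrite -(u'P i).2 -(v'P i).2 mulrACA.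
move=> [_ [n [u [v [Iu [Iv ->]]]]] <-].
exists n, (fun i => c * u i), (fun i => c * v i).
split; [|split] => [i|i|]; [by exists (u i)|by exists (v i)|].
by rewrite mulr_sumr; apply: eq_bigr => i _; rewrite mulrACA.
Qed.

Lemma ideal_sqr_principal (D : idomainType) (c : D) :
  ideal_sqr (principal_ideal c) = principal_ideal (c ^+ 2).
Proof.
(* A principal ideal is [c] times the whole ring, whose square is itself since [x = x * 1]. *)
rewrite [LHS]ideal_sqr_mull; congr image; apply/seteqP; split=> // x _.
exists 1, (fun=> x), (fun=> 1); do 2!split=> //.
by rewrite big_ord1 mulr1.
Qed.

Lemma principal_ideal_setIr (D : idomainType) (a b : D) :
  principal_ideal a b ->
  principal_ideal a `&` principal_ideal b = principal_ideal b.
Proof.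
case=> c _ <-; apply: setIidr => _ [d _ <-].
by exists (c * d); rewrite // mulrA.
Qed.

Lemma principal_ideal_sqr (D : idomainType) (a b : D) :
  principal_ideal a b -> principal_ideal (a ^+ 2) (b ^+ 2).
Proof. by case=> c _ <-; exists (c ^+ 2); rewrite // exprMn. Qed.

Lemma image_mulI (D : idomainType) (c : D) (I J : set D) : c != 0 ->
  [set c * x | x in I] = [set c * x | x in J] -> I = J.
Proof.
move=> /mulfI cI IJ; apply/funext => x.
by rewrite -(image_inj (f := *%R c)) // IJ image_inj.
Qed.

Section PseudoValuationDomain.
Variables (D : idomainType) (m : set D).
Hypothesis pvd : pseudo_valuation_domain m.

Let m_closed : idealr_closed [in m].
Proof. by case: pvd => -[[]]. Qed.

Lemma pvd_ideal0 : m 0.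
Proof. by case: m_closed; rewrite inE. Qed.

Lemma pvd_ideal1 : ~ m 1.
Proof. by case: m_closed => _ /negP; rewrite inE. Qed.

Lemma pvd_idealMl a u : m u -> m (a * u).
Proof.
case: m_closed => m0 _ mP mu; rewrite -[a * u]addr0; apply/set_mem.
by apply: mP => //; apply: mem_set.
Qed.

Lemma pvd_ideal_sqr_sub : ideal_sqr m `<=` m.
Proof.
move=> _ [n [u [v [_ [mv ->]]]]].
elim/big_ind: _ => [|x y mx my|i _]; [exact: pvd_ideal0| |exact: pvd_idealMl].
case: m_closed => _ _ mP; rewrite -[x]mul1r; apply/set_mem.
by apply: mP; apply: mem_set.
Qed.

(* With [x = b / a]: if [x] is not in [m] then [x^-1 m <= m]. *)
Lemma pvd_ideal_divl a b y : ~ [set a * z | z in m] b -> m y ->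
  [set b * z | z in m] (a * y).
Proof.
move=> nab my.
have [a0|a0] := eqVneq a 0.
  by exists 0; [exact: pvd_ideal0 | rewrite a0 mulr0 mul0r].
have b0 : b != 0.
  apply/eqP => b0; apply: nab; exists 0; first exact: pvd_ideal0.
  by rewrite mulr0 b0.
apply/in_frac_div => //.
(* The product of the two fractions is [y], which is in [m]; the assumption on [b] excludes the
   first factor. *)
case: pvd => _ /(_ (tofrac b / tofrac a) (tofrac (a * y) / tofrac b)) [].
- by exists y; rewrite // tofracM !mulrA divfK ?tofrac_eq0 // mulrC mulKf
    ?tofrac_eq0.
- by move/in_frac_div => /(_ a0).
- by [].
Qed.

(** The pseudo-valuation property puts [m] inside [d D]. If [d] were not a unit, [d D] would be a
    proper ideal, equal to [m] by maximality, and [d] would lie in [m]. *)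
Lemma pvd_unit d : ~ m d -> exists e, d * e = 1.
Proof.
move=> nmd.
have m_d : m `<=` principal_ideal d.
  move=> y my; have [|z _ dz] := @pvd_ideal_divl 1 d y _ my.
    by case=> z mz; rewrite mul1r => zd; apply: nmd; rewrite -zd.
  by exists z; rewrite // dz mul1r.
apply: contrapT => nunit; apply: nmd.
case: pvd => -[[_ max] _] _; rewrite -(max (principal_ideal d)) //.
  by exists 1; rewrite ?mulr1.
split=> [||a u v]; rewrite ?inE.
- by exists 0; rewrite ?mulr0.
- by apply/negP; rewrite inE => -[e _ de]; apply: nunit; exists e.
- move=> [u' _ <-] [v' _ <-]; exists (a * u' + v') => //.
  by rewrite mulrDr mulrCA.
Qed.

Lemma pvd_principal_ideal_setI a b :
    ~ principal_ideal a b -> ~ principal_ideal b a ->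
  principal_ideal a `&` principal_ideal b = [set a * z | z in m].
Proof.
move=> nab nba; apply/seteqP; split=> [_ [[d _ <-] [e _ be]]|_ [d md <-]].
  (* A coefficient [d] outside [m] would be a unit, and [a d = b e] would make [b] divide [a]. *)
  exists d => //; apply: contrapT => /pvd_unit [f df]; apply: nba.
  by exists (e * f); rewrite // mulrA be -mulrA df mulr1.
split; first by exists d.
have [|z _ <-] := @pvd_ideal_divl a b d _ md; last by exists z.
by case=> z _ az; apply: nab; exists z.
Qed.

Lemma pvd_star_pair a b :
    ~ principal_ideal a b -> ~ principal_ideal b a ->
  ideal_sqr (principal_ideal a `&` principal_ideal b) =
  [set a ^+ 2 * z | z in ideal_sqr m].
Proof. by move=> nab nba; rewrite pvd_principal_ideal_setI ?ideal_sqr_mull. Qed.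

Lemma pvd_star_two_root_closed : star_domain D -> two_root_closed D.
Proof.
move=> star; apply/two_root_closedP => a b ab2; apply: contrapT => nab.
have b0 : b != 0.
  by apply/eqP => b0; apply: nab; exists 0; rewrite ?mulr0 // b0.
(* If [a = b c] and [b ^+ 2 = a ^+ 2 * e], then [c] is a unit with inverse [c e], so [a] would
   divide [b]. *)
have nba : ~ principal_ideal b a.
  case=> c _ bc; case: ab2 => e _; rewrite -bc exprMn -mulrA => bce.
  have ce1 : c ^+ 2 * e = 1.
    by apply: (mulfI (expf_neq0 2 b0)); rewrite bce mulr1.
  by apply: nab; exists (c * e); rewrite // -bc -mulrA [c * _]mulrA -expr2 ce1
    mulr1.
(* As [a ^+ 2] divides [b ^+ 2], the left side of the star identity is [b ^+ 2 D]. *)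
have := star a b; rewrite pvd_star_pair // principal_ideal_setIr // => eqb.
have : principal_ideal (b ^+ 2) (b ^+ 2) by exists 1; rewrite ?mulr1.
rewrite eqb => -[e /pvd_ideal_sqr_sub me ae].
(* Here [e = x^2] is in [m] for [x = b / a], so [x = x^-1 e] is in [m]. *)
have [|z mz bz] := @pvd_ideal_divl a b e _ me.
  by case=> z _ az; apply: nab; exists z.
apply: nab; exists z => //; apply: (mulfI b0).
by rewrite mulrCA bz mulrA -!expr2 ae.
Qed.

End PseudoValuationDomain.

Theorem proposition2p3 (D : idomainType) (m : set D)
    (hD : pseudo_valuation_domain m) (hnv : ~ valuation_domain D) :
  star_domain D <-> (two_root_closed D /\ m = ideal_sqr m).
Proof.
split=> [star | [/two_root_closedP rc mm] a b].
  have rc := pvd_star_two_root_closed hD star; split=> //.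
  have [a [b [nab nba]]] := not_valuation_domain hnv.
  move/two_root_closedP: rc => rc.
  have a0 : a ^+ 2 != 0.
    rewrite sqrf_eq0; apply/eqP => a0; apply: nba.
    by exists 0; rewrite ?mulr0 // a0.
  (* After multiplication by [a ^+ 2], the star identity turns the right side into the intersection
     for the squares. These are incomparable by 2-root closure, so it is [a ^+ 2 m]. *)
  apply: (image_mulI a0); rewrite -(pvd_star_pair hD nab nba) -star.
  by rewrite (pvd_principal_ideal_setI hD) // => /rc.
(* If [a] divides [b], both sides are [b ^+ 2 D]; the second case is symmetric. *)
have [ab|nab] := pselect (principal_ideal a b).
  rewrite !principal_ideal_setIr ?ideal_sqr_principal //.
  exact: principal_ideal_sqr.
have [ba|nba] := pselect (principal_ideal b a).
  rewrite ![_ `&` principal_ideal b]setIC ![_ `&` principal_ideal (b ^+ 2)]setIC.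
  rewrite !principal_ideal_setIr ?ideal_sqr_principal //.
  exact: principal_ideal_sqr.
(* For incomparable [a] and [b], both sides are [a ^+ 2 m]. *)
rewrite (pvd_star_pair hD) // -mm.
by rewrite (pvd_principal_ideal_setI hD) // => /rc.
Qed.
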